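(* Let $C_{0}$ be an $\mathcal{HM}$-sentence, $\Gamma_{0}$ a finite set of $\mathcal{H}$-sentences, and $\alpha$ an ordinal. Suppose that $\vdash^{\alpha}_{2}\Gamma_{0}\Rightarrow C_{0}$. Then $\vdash^{\omega^{\alpha}+1}_{1}\Gamma_{0}\Rightarrow C_{0}$.
   Context: $L_{HA}$ is the first-order language of Heyting arithmetic $\mathrm{HA}$: equality $=$, constants $0,1$, function symbols $+,\cdot$, and logical connectives $\lor,\land,\to,\exists,\forall$; $\lnot A$ abbreviates $A\to\bot$. $X$ is a fresh unary predicate symbol and $L_{HA}(X)=L_{HA}\cup\{X\}$. The classes $\mathcal{H}$ of formulas in $L_{HA}$ and $\mathcal{HM}$ of formulas in $L_{HA}(X)$ are defined inductively by: (1) any atomic formula $s=t$ belongs to both $\mathcal{H}$ and $\mathcal{HM}$; (2) any atomic formula $X(t)$ belongs to $\mathcal{HM}$; (3) if $H,G\in\mathcal{H}$, then $H\land G,\ \forall x\,H\in\mathcal{H}$; (4) if $H\in\mathcal{H}$, then $A\to H\in\mathcal{H}$ for any formula $A\in L_{HA}$; (5) if $R,S\in\mathcal{HM}$, then $R\lor S,\ R\land S,\ \exists x\,R,\ \forall x\,R\in\mathcal{HM}$; (6) if $L\in\mathcal{H}$ and $R\in\mathcal{HM}$, then $L\to R\in\mathcal{HM}$. An $\mathcal{H}$-sentence is a closed formula in $\mathcal{H}$; an $\mathcal{HM}$-sentence is a closed formula in $\mathcal{HM}$ in which $X$ does not occur. The theory $\widehat{ID}^{i}(\mathcal{HM})$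 extends $\mathrm{HA}$ (over intuitionistic logic); its language adds to $L_{HA}$ a unary predicate constant $I^{\Phi}$ for each $\Phi\equiv\Phi(X,x)\in\mathcal{HM}$ in which only a fixed variable $x$ occurs freely, and its axioms are those of $\mathrm{HA}$ in the expanded language (with induction for all formulas of the expanded language) plus $\forall x[I^{\Phi}(x)\leftrightarrow\Phi(I^{\Phi},x)]$ for each such $\Phi$. Fixed number $N$: the logical complexity of a formula is the number of occurrences of logical connectives in it. A (finite) $\widehat{ID}^{i}(\mathcal{HM})$-derivation $D_0$ of an $\mathcal{HM}$-sentence is fixed, and $N$ is a fixed natural number so large that every formula occurring in $D_0$ has logical complexity less than $N$. Infinitary calculus $\widehat{ID}^{i\infty}(\mathcal{HM})$. Sequents are $\Gamma\Rightarrow A$, with $A$ a sentence in the language of $\widehat{ID}^{i}(\mathcal{HM})$ and $\Gamma$ a finite set of such sentences; each closed term is identified with its value, i.e. the numeral $\bar n$. $\Gamma,A$ denotes $\Gamma\cup\{A\}$. $\bot$ stands for any false closed equation and $\top$ for any true closed equation. $I$ stands for any of the $I^{\Phi}$. Initial sequents (regarded as rules with no premises): $\Gamma,I(t)\Rightarrow I(t)$; $\Gamma,\bot\Rightarrow A$; $\Gamma\Rightarrow\top$. Inference rules (premises / conclusion): - $(LI)$: $\Gamma,\Phi(I,t)\Rightarrow C$ / $\Gamma,I(t)\Rightarrow C$; $(RI)$: $\Gamma\Rightarrow\Phi(I,t)$ / $\Gamma\Rightarrow I(t)$ (with $I=I^{\Phi}$); - $(L\lor)$: $\Gamma,A_0\Rightarrow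 C$ and $\Gamma,A_1\Rightarrow C$ / $\Gamma,A_0\lor A_1\Rightarrow C$; $(R\lor)$: $\Gamma\Rightarrow A_i$ / $\Gamma\Rightarrow A_0\lor A_1$ ($i=0,1$); - $(L\land)$: $\Gamma,A_0\land A_1,A_i\Rightarrow C$ / $\Gamma,A_0\land A_1\Rightarrow C$ ($i=0,1$); $(R\land)$: $\Gamma\Rightarrow A_0$ and $\Gamma\Rightarrow A_1$ / $\Gamma\Rightarrow A_0\land A_1$; - $(L\to)$: $\Gamma,A\to B\Rightarrow A$ and $\Gamma,B\Rightarrow C$ / $\Gamma,A\to B\Rightarrow C$; $(R\to)$: $\Gamma,A\Rightarrow B$ / $\Gamma\Rightarrow A\to B$; - $(L\exists)$: $\Gamma,B(\bar n)\Rightarrow C$ for all $n\in\omega$ / $\Gamma,\exists x B(x)\Rightarrow C$; $(R\exists)$: $\Gamma\Rightarrow B(\bar n)$ / $\Gamma\Rightarrow\exists x B(x)$; - $(L\forall)$: $\Gamma,\forall x B(x),B(\bar n)\Rightarrow C$ / $\Gamma,\forall x B(x)\Rightarrow C$; $(R\forall)$: $\Gamma\Rightarrow B(\bar n)$ for all $n\in\omega$ / $\Gamma\Rightarrow\forall x B(x)$; - $(cut)$: $\Gamma\Rightarrow A$ and $\Delta,A\Rightarrow C$ / $\Gamma,\Delta\Rightarrow C$, with cut formula $A$; - $(Rep)$: $\Gamma\Rightarrow C$ / $\Gamma\Rightarrow C$. Infinitary derivations are well-founded trees built by these rules; the depth of an infinitary derivation is the (ordinal) depth of this well-founded tree. Rank.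 $\mathcal{HM}(I)$ is the class of sentences obtained from sentences in $\mathcal{HM}$ by substituting a predicate $I^{\Phi}$ for $X$. For a sentence $A$: $rk(A)=0$ if $A\in\mathcal{H}$; $rk(A)=1$ if $A\in\mathcal{HM}(I)\setminus\mathcal{H}$; $rk(A)=2$ otherwise. The rank of a cut inference is the rank of its cut formula; the rank of any other inference is $0$. The rank of a derivation is the maximum rank of the cut inferences in it (so $0$ if there are none). $\vdash^{\alpha}_{r}\Gamma\Rightarrow C$ means: there is an infinitary derivation of $\Gamma\Rightarrow C$ in $\widehat{ID}^{i\infty}(\mathcal{HM})$ whose depth is at most $\alpha$, whose rank is less than $r$, and in which every formula occurring has logical complexity less than $N$. *)

(* Defs.v *)
From HB Require Import structures.
From mathcomp Require Import all_boot finmap.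
From mathcomp Require Import boolp.

Set Implicit Arguments.
Unset Strict Implicit.
Unset Printing Implicit Defensive.

Local Open Scope fset_scope.

(** ** Ordinals *)

(* [Ord f] is the least ordinal greater than every [f i]. Ordinals are such
   well-founded trees compared by [ole]; trees with [ole a b] and [ole b a]
   denote the same ordinal. *)
Inductive ord : Type := Ord (J : Type) (f : J -> ord).

Fixpoint ole (a b : ord) : Prop :=
  let: Ord J f := a in let: Ord K g := b in
  forall j : J, exists k : K, ole (f j) (g k).

Definition oidx (a : ord) : Type := let: Ord J _ := a in J.

Definition opred (a : ord) : oidx a -> ord :=
  match a return oidx a -> ord with Ord _ f => f end.

Definition osup (J : Type) (f : J -> ord) : ord :=
  Ord (fun p : {j : J & oidx (f j)} => opred (tagged p)).

Definition ozero : ord := Ord (fun i : void => match i with end).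

Definition osucc (a : ord) : ord := Ord (fun _ : unit => a).

Definition oomega : ord := Ord (fun n : nat => iter n osucc ozero).

(* a + b = sup ({a} U {(a + c) + 1 | c < b}) *)
Fixpoint oadd (a b : ord) : ord :=
  let: Ord J g := b in
  osup (fun o : option J => if o is Some j then osucc (oadd a (g j)) else a).

(* a * b = sup {a * c + a | c < b} *)
Fixpoint omul (a b : ord) : ord :=
  let: Ord J g := b in osup (fun j : J => oadd (omul a (g j)) a).

(* a ^ b = sup ({1} U {a ^ c * a | c < b}), for a > 0 *)
Fixpoint oexp (a b : ord) : ord :=
  let: Ord J g := b in
  osup (fun o : option J =>
          if o is Some j then omul (oexp a (g j)) a else osucc ozero).

(** ** Syntax *)

(* Well-scoped de Bruijn syntax: [term n] and [form P n] have their free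
   variables in ['I_n], the variable bound by a quantifier being [ord0] in its
   body; [P] is the type of unary predicate symbols. *)
Inductive term (n : nat) : Type :=
| Var (i : 'I_n)
| Zero
| One
| Add (s t : term n)
| Mul (s t : term n).

Arguments Zero {n}.
Arguments One {n}.

Inductive form (P : Type) (n : nat) : Type :=
| Eqn (s t : term n)
| Pred (p : P) (t : term n)
| Or (A B : form P n)
| And (A B : form P n)
| Imp (A B : form P n)
| Ex (A : form P n.+1)
| All (A : form P n.+1).

Arguments Eqn {P n} s t.
Arguments Pred {P n} p t.

HB.instance Definition _ (P : Type) (n : nat) := gen_eqMixin (form P n).
HB.instance Definition _ (P : Type) (n : nat) := gen_choiceMixin (form P n).

Fixpoint tsubst m n (e : 'I_m -> term n) (t : term m) : term n :=
  match t with
  | Var i => e i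
  | Zero => Zero
  | One => One
  | Add s u => Add (tsubst e s) (tsubst e u)
  | Mul s u => Mul (tsubst e s) (tsubst e u)
  end.

Definition tlift n : term n -> term n.+1 :=
  tsubst (fun i => Var (lift ord0 i)).

Definition up m n (e : 'I_m -> term n) (i : 'I_m.+1) : term n.+1 :=
  if unlift ord0 i is Some j then tlift (e j) else Var ord0.

Fixpoint fsubst P m n (e : 'I_m -> term n) (A : form P m) : form P n :=
  match A with
  | Eqn s t => Eqn (tsubst e s) (tsubst e t)
  | Pred p t => Pred p (tsubst e t)
  | Or B C => Or (fsubst e B) (fsubst e C)
  | And B C => And (fsubst e B) (fsubst e C)
  | Imp B C => Imp (fsubst e B) (fsubst e C)
  | Ex B => Ex (fsubst (up e) B)
  | All B => All (fsubst (up e) B)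
  end.

Definition inst P (A : form P 1) (t : term 0) : form P 0 :=
  fsubst (fun _ => t) A.

Fixpoint psubst P Q n (f : P -> Q) (A : form P n) : form Q n :=
  match A with
  | Eqn s t => Eqn s t
  | Pred p t => Pred (f p) t
  | Or B C => Or (psubst f B) (psubst f C)
  | And B C => And (psubst f B) (psubst f C)
  | Imp B C => Imp (psubst f B) (psubst f C)
  | Ex B => Ex (psubst f B)
  | All B => All (psubst f B)
  end.

Fixpoint complexity P n (A : form P n) : nat :=
  match A with
  | Eqn _ _ | Pred _ _ => 0
  | Or B C | And B C | Imp B C => (complexity B + complexity C).+1%N
  | Ex B | All B => (complexity B).+1
  end.

(** ** The classes H and HM *)

(* no predicate symbol occurs in [A], i.e. [A] is a formula of L_HA *)
Fixpoint inLHA P n (A : form P n) : bool :=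
  match A with
  | Eqn _ _ => true
  | Pred _ _ => false
  | Or B C | And B C | Imp B C => inLHA B && inLHA C
  | Ex B | All B => inLHA B
  end.

Fixpoint inH P n (A : form P n) : bool :=
  match A with
  | Eqn _ _ => true
  | And B C => inH B && inH C
  | Imp B C => inLHA B && inH C
  | All B => inH B
  | Pred _ _ | Or _ _ | Ex _ => false
  end.

Fixpoint inHM P n (A : form P n) : bool :=
  match A with
  | Eqn _ _ | Pred _ _ => true
  | Or B C | And B C => inHM B && inHM C
  | Imp B C => inH B && inHM C
  | Ex B | All B => inHM B
  end.

(* [inHM] counts every predicate atom as an X-atom; at [P = unit] it is HM, and
   together with [inLHA] it describes the HM-formulas without X at any [P].
   [form unit n] is the language L_HA(X), the predicate symbol X being [tt];
   the constants I^Phi are indexed by [opform], whose only possible free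
   variable is the one of the scope ['I_1]. *)
Definition opform : Type := {Phi : form unit 1 | inHM Phi}.

(* Phi(I^Phi, t) *)
Definition unfold_op (Phi : opform) (t : term 0) : form opform 0 :=
  inst (psubst (fun _ : unit => Phi) (val Phi)) t.

(** ** Sentences: closed terms are identified with their values *)

Fixpoint numeral n (k : nat) : term n :=
  match k with
  | 0 => Zero
  | 1 => One
  | k'.+1 => Add (numeral n k') One
  end.

(* the value of a closed term, [None] if a variable occurs in it *)
Fixpoint tval n (t : term n) : option nat :=
  match t with
  | Var _ => None
  | Zero => Some 0
  | One => Some 1
  | Add s u => if (tval s, tval u) is (Some a, Some b) then Some (a + b)%N
               else None
  | Mul s u => if (tval s, tval u) is (Some a, Some b) then Some (a * b)%N
               else None
  end.

(* replaces each maximal closed subterm by its numeral *)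
Fixpoint tnorm n (t : term n) : term n :=
  if tval t is Some k then numeral n k else
  match t with
  | Add s u => Add (tnorm s) (tnorm u)
  | Mul s u => Mul (tnorm s) (tnorm u)
  | _ => t
  end.

Fixpoint fnorm P n (A : form P n) : form P n :=
  match A with
  | Eqn s t => Eqn (tnorm s) (tnorm t)
  | Pred p t => Pred p (tnorm t)
  | Or B C => Or (fnorm B) (fnorm C)
  | And B C => And (fnorm B) (fnorm C)
  | Imp B C => Imp (fnorm B) (fnorm C)
  | Ex B => Ex (fnorm B)
  | All B => All (fnorm B)
  end.

Lemma tval_numeral n k : tval (numeral n k) = Some k.
Proof.
elim: k => [|[|k] IH] //.
change (tval (Add (numeral n k.+1) One) = Some k.+2).
by rewrite [LHS]/= -/(numeral n k.+1) IH addn1.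
Qed.

Lemma tnorm_val n (t : term n) k : tval t = Some k -> tnorm t = numeral n k.
Proof. by case: t => [i|||s u|s u] //= => [[<-]|[<-]|->|->]. Qed.

Lemma tval_tnorm n (t : term n) : tval (tnorm t) = tval t.
Proof.
elim: t => [i|||s IHs u IHu|s IHs u IHu] //=;
  case: (tval s) IHs => [a|] IHs; case: (tval u) IHu => [b|] IHu;
  by rewrite ?tval_numeral //= IHs ?IHu.
Qed.

Lemma tnorm_idem n (t : term n) : tnorm (tnorm t) = tnorm t.
Proof.
elim: t => [i|||s IHs u IHu|s IHs u IHu] //=.
all: set v := (if tval s is Some _ then _ else _).
all: case Ev: v => [k|]; first by rewrite (tnorm_val (tval_numeral n k)).
all: by rewrite /= !tval_tnorm -/v Ev IHs IHu.
Qed.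

Lemma fnorm_idem P n (A : form P n) : fnorm (fnorm A) == fnorm A.
Proof.
apply/eqP; elim: A => {n} [n s t|n p t|n B IB C IC|n B IB C IC|n B IB C IC
  |n B IB|n B IB] /=; by rewrite ?tnorm_idem ?IB ?IC.
Qed.

(* Sentences of the fixed point theory modulo the identification of closed
   terms with their values, represented by normal forms. *)
Definition sentence : Type := {A : form opform 0 | fnorm A == A}.

Definition cls (A : form opform 0) : sentence :=
  exist (fun B => fnorm B == B) (fnorm A) (fnorm_idem A).

Definition H_sentence (A : sentence) : bool := inH (val A).

Definition HM_sentence (A : sentence) : bool :=
  inHM (val A) && inLHA (val A).

(** ** Rank *)

Definition inHMI (A : sentence) : Prop :=
  exists (R : form unit 0) (Phi : opform),
    inHM R /\ A = cls (psubst (fun _ : unit => Phi) R).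

Definition rk (A : sentence) : nat :=
  if H_sentence A then 0 else if `[< inHMI A >] then 1 else 2.

(** ** The infinitary calculus *)

Record sequent : Type := Sequent { ante : {fset sentence}; conseq : sentence }.

Notation "G =>> C" := (Sequent G C) (at level 70, no associativity).

(* [inference prem s]: from the premises [prem j], j in J, infer [s]. *)
Inductive inference : forall J : Set, (J -> sequent) -> sequent -> Type :=
| InitI G Phi t :
    inference (fun j : void => match j with end)
              (cls (Pred Phi t) |` G =>> cls (Pred Phi t))
| InitBot G s t C of tval s != tval t :
    inference (fun j : void => match j with end) (cls (Eqn s t) |` G =>> C)
| InitTop G s t of tval s = tval t :
    inference (fun j : void => match j with end) (G =>> cls (Eqn s t))
| LI G Phi t C :
    inference (fun _ : unit => cls (unfold_op Phi t) |` G =>> C)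
              (cls (Pred Phi t) |` G =>> C)
| RI G Phi t :
    inference (fun _ : unit => G =>> cls (unfold_op Phi t))
              (G =>> cls (Pred Phi t))
| LOr G A0 A1 C :
    inference (fun i : bool => cls (if i then A1 else A0) |` G =>> C)
              (cls (Or A0 A1) |` G =>> C)
| ROr G A0 A1 (i : bool) :
    inference (fun _ : unit => G =>> cls (if i then A1 else A0))
              (G =>> cls (Or A0 A1))
| LAnd G A0 A1 C (i : bool) :
    inference (fun _ : unit =>
                 cls (if i then A1 else A0) |` (cls (And A0 A1) |` G) =>> C)
              (cls (And A0 A1) |` G =>> C)
| RAnd G A0 A1 :
    inference (fun i : bool => G =>> cls (if i then A1 else A0))
              (G =>> cls (And A0 A1))
| LImp G A B C :
    inference (fun i : bool => if i then cls B |` G =>> C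
                               else cls (Imp A B) |` G =>> cls A)
              (cls (Imp A B) |` G =>> C)
| RImp G A B :
    inference (fun _ : unit => cls A |` G =>> cls B) (G =>> cls (Imp A B))
| LEx G B C :
    inference (fun n : nat => cls (inst B (numeral 0 n)) |` G =>> C)
              (cls (Ex B) |` G =>> C)
| REx G B (n : nat) :
    inference (fun _ : unit => G =>> cls (inst B (numeral 0 n)))
              (G =>> cls (Ex B))
| LAll G B C (n : nat) :
    inference (fun _ : unit =>
                 cls (inst B (numeral 0 n)) |` (cls (All B) |` G) =>> C)
              (cls (All B) |` G =>> C)
| RAll G B :
    inference (fun n : nat => G =>> cls (inst B (numeral 0 n)))
              (G =>> cls (All B))
| Cut G D A C :
    inference (fun i : bool => if i then A |` D =>> C else G =>> A)
              (G `|` D =>> C)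
| Rep G C :
    inference (fun _ : unit => G =>> C) (G =>> C).

Definition inference_rank (J : Set) (prem : J -> sequent) s (r : inference prem s) :
    nat :=
  if r is Cut _ _ A _ then rk A else 0.

Inductive derivation : sequent -> Type :=
| Infer (J : Set) (prem : J -> sequent) (s : sequent) (r : inference prem s)
    (d : forall j, derivation (prem j)) : derivation s.

Fixpoint depth s (d : derivation s) : ord :=
  let: Infer _ _ _ _ ds := d in Ord (fun j => depth (ds j)).

(* Ranks of inferences are at most 2, so the maximum rank is less than [r] iff
   the rank of every inference is. *)
Fixpoint rank_lt (r : nat) s (d : derivation s) : Prop :=
  let: Infer _ _ _ i ds := d in
  (inference_rank i < r)%N /\ forall j, rank_lt r (ds j).

Fixpoint complexity_lt (N : nat) s (d : derivation s) : Prop :=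
  let: Infer _ _ s' _ ds := d in
  [/\ forall A, A \in ante s' -> (complexity (val A) < N)%N,
      (complexity (val (conseq s')) < N)%N
    & forall j, complexity_lt N (ds j)].

Definition derivable (N : nat) (alpha : ord) (r : nat) (s : sequent) : Prop :=
  exists d : derivation s,
    [/\ ole (depth d) alpha, rank_lt r d & complexity_lt N d].

(* Main.v *)
(** All formulas of [Gamma0 =>> C0] lie in L_HA. Interpreting each [I^Phi] by
    the least fixed point of [Phi], which exists because [X] occurs only strictly
    positively in HM-formulas, makes every rule of the calculus, cuts included,
    sound for truth in the standard model, so the endsequent is true.
    Conversely, by the omega-rule every true sentence of L_HA has a cut-free
    derivation, and every false one a cut-free refutation, of finite depth and
    built from its subformulas. A derivation of positive depth may thus be
    replaced by one of finite depth, and finite ordinals are below [omega^alpha]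
    for [alpha > 0]; a derivation of depth [0] is an initial sequent and contains
    no cut. *)
From mathcomp Require Import all_boot finmap boolp.
Require Import Defs.

Set Implicit Arguments.
Unset Strict Implicit.
Unset Printing Implicit Defensive.

Local Open Scope fset_scope.

(** * Ordinals *)

Lemma oleE a b :
  ole a b <-> forall i : oidx a, exists k : oidx b, ole (opred i) (opred k).
Proof. by case: a => J f; case: b => K g. Qed.

Lemma ole_refl a : ole a a.
Proof. by elim: a => J f IH /= j; exists j. Qed.

Lemma ole_trans b a c : ole a b -> ole b c -> ole a c.
Proof.
elim: a b c => J f IH [K g] [L h] /= ab bc j.
have [k fg] := ab j; have [l gh] := bc k.
by exists l; apply: IH fg gh.
Qed.

Lemma ole_osucc a : ole a (osucc a).
Proof.
(* An immediate subtree lies below its tree. Naming [f j] as [b] lets the induction run on the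
   subtree while the family [f] varies. *)
have lt J (f : J -> ord) j : ole (f j) (Ord f).
  have [b e] : exists b, f j = b by exists (f j).
  elim: b J f j e => K g IH J f j e; rewrite e /= => k.
  by exists j; rewrite e; apply: (IH k).
by case: a => J f /= j; exists tt; apply: lt.
Qed.

Lemma ole_osup J (f : J -> ord) j : ole (f j) (osup f).
Proof.
by apply/oleE => i; exists (Tagged (fun j => oidx (f j)) i); apply: ole_refl.
Qed.

Lemma oexp_gt0 a b : ole (osucc ozero) (oexp a b).
Proof. by case: b => J g; apply: (ole_osup _ None). Qed.

Lemma ole_oadd a b : ole a (oadd a b).
Proof. by case: b => J g; apply: (ole_osup _ None). Qed.

(** A positive [b] has some index [j], and the term [(a + g j) + 1] of the supremum defining [a + b]
    already dominates [a + 1]. *)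
Lemma oadd_gt a b : ole (osucc ozero) b -> ole (osucc a) (oadd a b).
Proof.
case: b => J g /(_ tt) [j _].
apply: (@ole_trans (osucc (oadd a (g j)))); last exact: (ole_osup _ (Some j)).
by move=> ?; exists tt; apply: ole_oadd.
Qed.

(** By induction on [m]: [a * (m + 1) = a * m + a] exceeds [a * m] because [a] is positive. *)
Lemma omul_ge_iter a m : ole (osucc ozero) a ->
  ole (iter m osucc ozero) (omul a (iter m osucc ozero)).
Proof.
move=> a0; elim: m => [|m IH]; first by apply/oleE => -[].
rewrite iterS.
apply: (@ole_trans (osucc (omul a (iter m osucc ozero)))).
  by move=> ?; exists tt.
by apply: ole_trans (oadd_gt _ a0) _; apply: (ole_osup _ tt).
Qed.

(** The index [j] witnesses that the exponent is positive. With [a = omega ^ (g j)], the power is at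
    least [a * omega], which bounds every [a * m], hence every [m]. *)
Lemma ole_iter_oexp m J (g : J -> ord) (j : J) :
  ole (iter m osucc ozero) (oexp oomega (Ord g)).
Proof.
have a0 := oexp_gt0 oomega (g j); set a := oexp _ _ in a0.
apply: (@ole_trans (omul a oomega)); last exact: (ole_osup _ (Some j)).
apply: (ole_trans (omul_ge_iter m a0)).
apply: (@ole_trans (oadd (omul a (iter m osucc ozero)) a)).
  exact: ole_oadd.
exact: (ole_osup (fun m => oadd (omul a (iter m osucc ozero)) a) m).
Qed.

(** * Truth in the standard model *)

Fixpoint teval n (rho : 'I_n -> nat) (t : term n) : nat :=
  match t with
  | Var i => rho i
  | Zero => 0
  | One => 1
  | Add s u => teval rho s + teval rho u
  | Mul s u => teval rho s * teval rho u
  end.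

Definition env_cons n (x : nat) (rho : 'I_n -> nat) (i : 'I_n.+1) : nat :=
  oapp rho x (unlift ord0 i).

Fixpoint feval P (V : P -> nat -> Prop) n (rho : 'I_n -> nat) (A : form P n) :
    Prop :=
  match A with
  | Eqn s t => teval rho s = teval rho t
  | Pred p t => V p (teval rho t)
  | Or B C => feval V rho B \/ feval V rho C
  | And B C => feval V rho B /\ feval V rho C
  | Imp B C => feval V rho B -> feval V rho C
  | Ex B => exists x, feval V (env_cons x rho) B
  | All B => forall x, feval V (env_cons x rho) B
  end.

Lemma teval_tval n (rho : 'I_n -> nat) t k : tval t = Some k -> teval rho t = k.
Proof.
elim: t k => [i|||s IHs u IHu|s IHs u IHu] k //=; try by case.
all: case: (tval s) IHs => // a /(_ _ erefl) ->.
all: by case: (tval u) IHu => // b /(_ _ erefl) -> [].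
Qed.

Lemma tval_closed (rho : 'I_0 -> nat) t : tval t = Some (teval rho t).
Proof. by elim: t => [[]|||s IHs u IHu|s IHs u IHu] //=; rewrite IHs IHu. Qed.

Lemma teval_tnorm n (rho : 'I_n -> nat) t : teval rho (tnorm t) = teval rho t.
Proof.
have num k : teval rho (numeral n k) = k by apply/teval_tval/tval_numeral.
elim: t => [i|||s IHs u IHu|s IHs u IHu] //=.
all: case es: (tval s) => [a|]; last by rewrite /= IHs IHu.
all: case eu: (tval u) => [b|]; last by rewrite /= IHs IHu.
all: by rewrite num (teval_tval _ es) (teval_tval _ eu).
Qed.

Lemma teval_tsubst m n (rho : 'I_n -> nat) (e : 'I_m -> term n) t :
  teval rho (tsubst e t) = teval (fun i => teval rho (e i)) t.
Proof. by elim: t => [i|||s IHs u IHu|s IHs u IHu] //=; rewrite IHs IHu. Qed.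

Lemma teval_up m n x (rho : 'I_n -> nat) (e : 'I_m -> term n) :
  (fun i => teval (env_cons x rho) (up e i)) =
  env_cons x (fun i => teval rho (e i)).
Proof.
apply: funext => i; rewrite /up /env_cons; case: unliftP => [j _|_] /=.
  rewrite teval_tsubst; congr teval; apply: funext => k /=.
  by rewrite /env_cons liftK.
by rewrite unlift_none.
Qed.

Lemma feval_fsubst P (V : P -> nat -> Prop) m n (rho : 'I_n -> nat)
    (e : 'I_m -> term n) A :
  feval V rho (fsubst e A) = feval V (fun i => teval rho (e i)) A.
Proof.
elim: A n rho e => {m} [m s t|m p t|m B IB C IC|m B IB C IC|m B IB C IC
  |m B IB|m B IB] n rho e /=; rewrite ?teval_tsubst ?IB ?IC //.
- by apply: eq_exists => x; rewrite IB teval_up.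
- by apply: eq_forall => x; rewrite IB teval_up.
Qed.

Lemma feval_fnorm P (V : P -> nat -> Prop) n (rho : 'I_n -> nat) A :
  feval V rho (fnorm A) = feval V rho A.
Proof.
elim: A rho => {n} [n s t|n p t|n B IB C IC|n B IB C IC|n B IB C IC
  |n B IB|n B IB] rho /=; rewrite ?teval_tnorm ?IB ?IC //.
- exact: eq_exists.
- exact: eq_forall.
Qed.

Lemma feval_psubst P Q (V : Q -> nat -> Prop) (f : P -> Q) n
    (rho : 'I_n -> nat) A :
  feval V rho (psubst f A) = feval (fun p => V (f p)) rho A.
Proof.
elim: A rho => {n} [n s t|n p t|n B IB C IC|n B IB C IC|n B IB C IC
  |n B IB|n B IB] rho //=; rewrite ?IB ?IC //.
- exact: eq_exists.
- exact: eq_forall.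
Qed.

Lemma feval_inst P (V : P -> nat -> Prop) rho (A : form P 1) t :
  feval V rho (inst A t) = feval V (env_cons (teval rho t) rho) A.
Proof.
rewrite feval_fsubst; congr feval; apply: funext => i.
by rewrite /env_cons; case: unliftP => [[]|].
Qed.

Lemma feval_LHA P (V W : P -> nat -> Prop) n (rho : 'I_n -> nat) A :
  inLHA A -> feval V rho A = feval W rho A.
Proof.
elim: A rho => {n} [n s t|n p t|n B IB C IC|n B IB C IC|n B IB C IC
  |n B IB|n B IB] rho //=.
1-3: by case/andP => hB hC; rewrite IB ?IC.
- by move=> hB; apply: eq_exists => x; apply: IB.
- by move=> hB; apply: eq_forall => x; apply: IB.
Qed.

(** H has no predicate atoms, and the antecedents of its implications are required to lie in
    L_HA. *)
Lemma inH_inLHA P n (A : form P n) : inH A -> inLHA A.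
Proof.
elim: A => {n} [n s t|n p t|n B IB C IC|n B IB C IC|n B IB C IC
  |n B IB|n B IB] //=.
- by case/andP => /IB -> /IC ->.
- by case/andP => -> /IC ->.
Qed.

(** Implication is the only critical case: its antecedent is in H, so it contains no predicate and
    has the same truth value under [V] and [W]. *)
Lemma feval_HM_mono P (V W : P -> nat -> Prop) n (rho : 'I_n -> nat) A :
  (forall p x, V p x -> W p x) -> inHM A -> feval V rho A -> feval W rho A.
Proof.
move=> VW; elim: A rho => {n} [n s t|n p t|n B IB C IC|n B IB C IC|n B IB C IC
  |n B IB|n B IB] rho //=.
- by move=> _; apply: VW.
- by case/andP => hB hC [/IB|/IC] h; [left|right]; apply: h.
- by case/andP => hB hC [/IB hB' /IC hC']; split; [apply: hB'|apply: hC'].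
- case/andP => /inH_inLHA hB hC h.
  by rewrite (feval_LHA W V) // => /h /IC; apply.
- by move=> hB [x /IB h]; exists x; apply: h.
- by move=> hB h x; apply: IB.
Qed.

(** * Least fixed points of HM-operators *)

Definition lfp (Phi : opform) (k : nat) : Prop :=
  forall S : nat -> Prop,
    (forall x, feval (fun _ => S) (fun _ => x) (val Phi) -> S x) -> S k.

(** Knaster-Tarski: [lfp Phi] is the intersection of all sets closed under the monotone operator of
    [Phi]. *)
Lemma lfpE Phi k :
  lfp Phi k <-> feval (fun _ => lfp Phi) (fun _ => k) (val Phi).
Proof.
have fold x : feval (fun _ => lfp Phi) (fun _ => x) (val Phi) -> lfp Phi x.
  move=> h S hS; apply: (hS); apply: feval_HM_mono h; last exact: valP.
  by move=> _ y; apply.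
split=> [h|/fold //].
(* The image of [lfp Phi] under the operator is itself closed, by [fold] and monotonicity, so it
   contains [lfp Phi]. *)
apply: (h (fun x => feval (fun _ => lfp Phi) (fun _ => x) (val Phi))) => x.
apply: feval_HM_mono; last exact: valP.
by move=> _; apply: fold.
Qed.

Definition holds (A : form opform 0) : Prop := feval lfp (fun _ => 0) A.

Lemma holds_cls A : holds (val (cls A)) = holds A.
Proof. exact: feval_fnorm. Qed.

Lemma holds_inst B n :
  holds (inst B (numeral 0 n)) = feval lfp (env_cons n (fun _ => 0)) B.
Proof. by rewrite /holds feval_inst (teval_tval _ (tval_numeral 0 n)). Qed.

Lemma holds_unfold_op Phi t :
  holds (unfold_op Phi t) <-> holds (Pred Phi t).
Proof. by rewrite /holds feval_fsubst feval_psubst /=; symmetry; apply: lfpE. Qed.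

(** * Soundness of the infinitary calculus *)

Definition valid (s : sequent) : Prop :=
  (forall A, A \in ante s -> holds (val A)) -> holds (val (conseq s)).

Lemma valid_cons A G C :
  valid (A |` G =>> C) <-> (holds (val A) -> valid (G =>> C)).
Proof.
split=> [h hA hG|h hAG]; first by apply: h => B /fset1UP [->|/hG].
by apply: (h (hAG A (fset1U1 _ _))) => B BG; apply/hAG/fset1Ur.
Qed.

Lemma inference_sound (J : Set) (prem : J -> sequent) s :
  inference prem s -> (forall j, valid (prem j)) -> valid s.
Proof.
have left X G C : valid (cls X |` G =>> C) <-> (holds X -> valid (G =>> C)).
  by rewrite -(holds_cls X); apply: valid_cons.
have right X G : valid (G =>> cls X) =
    ((forall A, A \in G -> holds (val A)) -> holds X).
  by rewrite -(holds_cls X).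
case=> {J prem s}.
- by move=> G Phi t _; apply/left => hA; rewrite right.
- move=> G s t C ne _; apply/left => /= e; case/eqP: ne.
  by rewrite !(tval_closed (fun _ => 0)) e.
- move=> G s t e _; rewrite right => _; rewrite /holds /=.
  by move: e; rewrite !(tval_closed (fun _ => 0)) => -[].
- by move=> G Phi t C /(_ tt)/left h; apply/left => /holds_unfold_op.
- by move=> G Phi t /(_ tt); rewrite !right => h /h /holds_unfold_op.
- move=> G A0 A1 C h; have /left h0 := h false; have /left h1 := h true.
  by apply/left => -[].
- move=> G A0 A1 i /(_ tt); rewrite !right => h /h; case: i {h} => h.
    by right.
  by left.
- move=> G A0 A1 C i /(_ tt)/left h; apply/left => hA.
  suff /h/left : holds (if i then A1 else A0) by apply.
  by case: i {h}; case: hA.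
- move=> G A0 A1 h; have := h false; have := h true; rewrite !right.
  by move=> h1 h0 hG; split; [apply: h0|apply: h1].
- move=> G A B C h; apply/left => hAB hG; have /left h1 := h true.
  have /left /(_ hAB) := h false; rewrite right => h0.
  exact: h1 (hAB (h0 hG)) hG.
- by move=> G A B /(_ tt)/left; rewrite !right => h hG /h; apply.
- move=> G B C h; apply/left => -[n hn]; have /left := h n; apply.
  by rewrite holds_inst.
- move=> G B n /(_ tt); rewrite !right holds_inst => h /h hn.
  by exists n.
- move=> G B C n /(_ tt)/left h; apply/left => hB.
  suff /h/left : holds (inst B (numeral 0 n)) by apply.
  by rewrite holds_inst; apply: hB.
- move=> G B h; rewrite right => hG n.
  by have := h n; rewrite right holds_inst; apply.
(* Cut: the premise over [G] makes the cut formula true, whatever its rank, and the premise over [D]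
   then applies. *)
- move=> G D A C h hGD; have /valid_cons := h true; apply.
    by apply: (h false) => B BG; apply: hGD; rewrite inE BG.
  by move=> B BD; apply: hGD; rewrite inE BD orbT.
- by move=> G C /(_ tt).
Qed.

Lemma derivation_sound s : derivation s -> valid s.
Proof. by elim=> J prem {}s r _; apply: inference_sound. Qed.

(** * Completeness for L_HA *)

Lemma complexity_fsubst P m n (e : 'I_m -> term n) (A : form P m) :
  complexity (fsubst e A) = complexity A.
Proof.
by elim: A n e => {m} [m s t|m p t|m B IB C IC|m B IB C IC|m B IB C IC
  |m B IB|m B IB] n e //=; rewrite ?IB ?IC.
Qed.

Lemma complexity_fnorm P n (A : form P n) : complexity (fnorm A) = complexity A.
Proof.
by elim: A => {n} [n s t|n p t|n B IB C IC|n B IB C IC|n B IB C IC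
  |n B IB|n B IB] //=; rewrite ?IB ?IC.
Qed.

Lemma inLHA_fsubst P m n (e : 'I_m -> term n) (A : form P m) :
  inLHA (fsubst e A) = inLHA A.
Proof.
by elim: A n e => {m} [m s t|m p t|m B IB C IC|m B IB C IC|m B IB C IC
  |m B IB|m B IB] n e //=; rewrite ?IB ?IC.
Qed.

Definition bounded N (G : {fset sentence}) : Prop :=
  forall A, A \in G -> complexity (val A) < N.

Lemma bounded_cons N A G :
  complexity A < N -> bounded N G -> bounded N (cls A |` G).
Proof. by move=> hA hG B /fset1UP [->|/hG //]; rewrite /= complexity_fnorm. Qed.

(** There may be infinitely many premises: [cid] chooses a derivation of each, and the common bound
    [a] on their depths gives [osucc a] for the whole tree. *)
Lemma derivable_infer N a r (J : Set) (prem : J -> sequent) s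
    (i : inference prem s) :
  inference_rank i < r -> bounded N (ante s) ->
  complexity (val (conseq s)) < N ->
  (forall j, derivable N a r (prem j)) -> derivable N (osucc a) r s.
Proof.
move=> hr hG hC h; exists (Infer i (fun j => sval (cid (h j)))); split=> /=.
- by move=> j; exists tt; case: cid => d [].
- by split=> // j; case: cid => d [].
- by split=> // j; case: cid => d [].
Qed.

Lemma endsequent_bounded N s (d : derivation s) : complexity_lt N d ->
  bounded N (ante s) /\ complexity (val (conseq s)) < N.
Proof. by case: d => J prem {}s i ds []. Qed.

(** Depth zero means that the last inference has no premises, whereas a cut has two; every other
    inference has rank 0. *)
Lemma rank_lt_depth0 r s (d : derivation s) :
  (oidx (depth d) -> False) -> rank_lt r.+1 d.
Proof.
case: d => J prem {}s i ds /= empty; split; last by move=> j; case: (empty j).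
by case: i ds empty => // G D A C _ /(_ true).
Qed.

(** Both halves are proved together, since implication exchanges the sides. The induction is on a
    complexity bound because quantifier premises are instances of the body, not subformulas.
    Arbitrary side formulas build weakening into the statement. *)
Lemma LHA_decided N m (A : form opform 0) :
  complexity A <= m -> complexity A < N -> inLHA A ->
  (holds A -> forall G, bounded N G ->
     derivable N (iter m.+1 osucc ozero) 1 (G =>> cls A)) /\
  (~ holds A -> forall G C, bounded N G -> complexity (val C) < N ->
     derivable N (iter m.+1 osucc ozero) 1 (cls A |` G =>> C)).
Proof.
(* The depth [a] is left free because equations occur at every stage [m] of the induction. *)
have eqn a s t : 0 < N ->
    (holds (Eqn s t) -> forall G, bounded N G ->
       derivable N (osucc a) 1 (G =>> cls (Eqn s t))) /\
    (~ holds (Eqn s t) -> forall G C, bounded N G -> complexity (val C) < N ->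
       derivable N (osucc a) 1 (cls (Eqn s t) |` G =>> C)).
  move=> N0; split=> [h G hG|h G C hG hC].
    have e : tval s = tval t by rewrite !(tval_closed (fun _ => 0)) h.
    by apply: (derivable_infer (i := InitTop G e)) => // -[].
  have ne : tval s != tval t.
    by apply/eqP; rewrite !(tval_closed (fun _ => 0)) => -[].
  by apply: (derivable_infer (i := InitBot G C ne)) => //; apply: bounded_cons.
elim: m A => [|m IH] [s t|p t|B D|B D|B D|B|B] // Am AN hA;
  try exact: eqn; rewrite iterS; move: (iter m.+1 osucc ozero) IH => a IH.
all: have := AN; rewrite -complexity_fnorm => cA.
all: have bA G := @bounded_cons N _ G AN.
all: have AN' := AN; rewrite /= in Am AN' hA.
1-3: have /andP[hB hD] := hA; have [BN DN] : complexity B < N /\ complexity D < N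
  by split; apply: leq_ltn_trans AN'; apply: leqW; rewrite (leq_addr, leq_addl).
1-3: have [tB fB] := IH B (leq_trans (leq_addr _ _) Am) BN hB.
1-3: have [tD fD] := IH D (leq_trans (leq_addl _ _) Am) DN hD.
4,5: have BN n : complexity (inst B (numeral 0 n)) < N
  by rewrite /inst complexity_fsubst; apply: ltnW.
4,5: have Bm n : complexity (inst B (numeral 0 n)) <= m
  by rewrite /inst complexity_fsubst.
4,5: have hB n : inLHA (inst B (numeral 0 n)) by rewrite /inst inLHA_fsubst.
4,5: have tB n := (IH _ (Bm n) (BN n) (hB n)).1.
4,5: have fB n := (IH _ (Bm n) (BN n) (hB n)).2.
- split=> [h G hG|h G C hG hC].
    case: h => h.
      by apply: (derivable_infer (i := ROr G B D false)) => // _; apply: tB.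
    by apply: (derivable_infer (i := ROr G B D true)) => // _; apply: tD.
  apply: (derivable_infer (i := LOr G B D C)) => //; first exact: bA.
  by case=> /=; [apply: fD|apply: fB] => // ?; apply: h; [right|left].
- split=> [[h1 h2] G hG|h G C hG hC].
    by apply: (derivable_infer (i := RAnd G B D)) => // -[]; [apply: tD|apply: tB].
  (* The left rule keeps one conjunct, so a false one must be selected. *)
  have bG := bA G hG; have [hb|hb] := EM (holds B).
    apply: (derivable_infer (i := LAnd G B D C true)) => // _.
    by apply: fD => // hd; apply: h.
  by apply: (derivable_infer (i := LAnd G B D C false)) => // _; apply: fB.
- split=> [h G hG|h G C hG hC].
    apply: (derivable_infer (i := RImp G B D)) => // _.
    (* A false antecedent is refuted on the left; under a true one, the consequent is true and
       derivable. *)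
    have [hb|hb] := EM (holds B); last by apply: fB; rewrite //= complexity_fnorm.
    by apply: tD; [apply: h|apply: bounded_cons].
  (* Classically, a false implication has a true antecedent and a false consequent, which supply the
     two premises. *)
  have bG := bA G hG; have hb : holds B by apply: contrapT => nB; apply: h => /nB.
  apply: (derivable_infer (i := LImp G B D C)) => // -[]; last exact: tB.
  by apply: fD => // hd; apply: h.
- split=> [[n hn] G hG|h G C hG hC].
    apply: (derivable_infer (i := REx G B n)) => // _.
    by apply: tB => //; rewrite holds_inst.
  apply: (derivable_infer (i := LEx G B C)) => // [|n]; first exact: bA.
  by apply: fB => //; rewrite holds_inst => hn; apply: h; exists n.
- split=> [h G hG|h G C hG hC].
    apply: (derivable_infer (i := RAll G B)) => // n.
    by apply: tB => //; rewrite holds_inst; apply: h.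
  have [n hn] : exists n, ~ holds (inst B (numeral 0 n)).
    apply: contrapT => hn; apply: h => n; apply: contrapT => hBn.
    by apply: hn; exists n; rewrite holds_inst.
  have bG := bA G hG.
  by apply: (derivable_infer (i := LAll G B C n)) => // _; apply: fB.
Qed.

Theorem theorem3p1 (N : nat) (C0 : sentence) (Gamma0 : {fset sentence})
    (alpha : ord)
    (hC0 : HM_sentence C0)
    (hGamma0 : forall A : sentence, A \in Gamma0 -> H_sentence A)
    (hder : derivable N alpha 2 (Gamma0 =>> C0)) :
  derivable N (osucc (oexp oomega alpha)) 1 (Gamma0 =>> C0).
Proof.
have [d [dle _ dN]] := hder.
have [G0N C0N] := endsequent_bounded dN; rewrite /= in G0N C0N.
(* For [alpha = 0] the target bound is only 2, which need not accommodate the derivations from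
   [LHA_decided]; hence the split on the depth of [d]. *)
have [[j _]|nJ] := EM (exists j : oidx (depth d), True).
  have fin m : derivable N (iter m osucc ozero) 1 (Gamma0 =>> C0) ->
      derivable N (osucc (oexp oomega alpha)) 1 (Gamma0 =>> C0).
    case=> d' [d'le ? ?]; exists d'; split=> //; apply: (ole_trans d'le).
    (* Since [depth d] is at most [alpha], its index [j] yields an index [k] of [alpha], so [alpha]
       is positive. *)
    case: alpha dle {hder} => K g /oleE /(_ j) [k _].
    exact: ole_trans (ole_iter_oexp m g k) (ole_osucc _).
  have clsK A : cls (val A) = A by apply/val_inj/eqP/(valP A).
  (* If the antecedent is true, soundness of [d] makes [C0] true and derivable; otherwise some false
     member of [Gamma0] is refuted with succedent [C0]. *)
  have [tr|ntr] := EM (forall A, A \in Gamma0 -> holds (val A)).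
    have /andP[_ /(LHA_decided (leqnn _) C0N) [+ _]] := hC0.
    by rewrite clsK => /(_ (derivation_sound d tr) _ G0N); apply: fin.
  have [A [AG nA]] : exists A, A \in Gamma0 /\ ~ holds (val A).
    apply: contrapT => nA; apply: ntr => A AG; apply: contrapT => hA.
    by apply: nA; exists A.
  have [_ /(_ nA _ _ G0N C0N)] :=
    LHA_decided (leqnn _) (G0N A AG) (inH_inLHA (hGamma0 A AG)).
  (* The refuted [A] already belongs to [Gamma0], so adding it leaves the antecedent unchanged. *)
  by rewrite clsK mem_fset1U //; apply: fin.
have empty : oidx (depth d) -> False by move=> j; apply: nJ; exists j.
(* At depth zero [d] itself serves: its depth lies below every ordinal. *)
exists d; split=> //; first by apply/oleE => j; case: (empty j).
exact: rank_lt_depth0.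
Qed.
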